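(* Let $DB$ be a finite uncertain sequential database and let $\alpha$ and $\alpha'$ be nonempty sequences with $\alpha \subseteq \alpha'$ (that is, $\alpha$ is a subsequence of $\alpha'$). Then $$expSup^{cap}(\alpha)\ \ge\ expSup(\alpha)\qquad\text{and}\qquad expSup(\alpha)\ \ge\ expSup(\alpha'),$$ and therefore $expSup^{cap}(\alpha)\ge expSup(\alpha')$. In particular, for every real threshold $\gamma$, if $expSup^{cap}(\alpha)<\gamma$, then $expSup(\alpha)<\gamma$ and $expSup(\alpha')<\gamma$ for every sequence $\alpha'\supseteq\alpha$.
   Context: Let $I$ be a finite set of items with a fixed total (lexicographic) order. An event is a nonempty finite subset of $I$, and a sequence is a finite ordered list of events $\alpha=\langle e_1 e_2\cdots e_r\rangle$. The length of $\alpha$ is its total number of item occurrences $\sum_j |e_j|$. Items inside an event are listed in lexicographic order, so a sequence of length $m$ has a well-defined list of items $i_1,\dots,i_m$. For $0\le k\le m$, $\alpha_k$ denotes the prefix of $\alpha$ consisting of its first $k$ items ($\alpha_0$ is empty, $\alpha_m=\alpha$). Each $\alpha_k$ is obtained from $\alpha_{k-1}$ by appending $i_k$, either as an s-extension ($i_k$ is added as a new event at the end) or as an i-extension ($i_k$ is inserted in the last event of $\alpha_{k-1}$, where it is lexicographically larger than all items already there). Subsequence: $\langle e_1\cdots e_r\rangle\subseteq\langle f_1\cdots f_n\rangle$ if there are indices $j_1<\dots<j_r$ with $e_t\subseteq f_{j_t}$ for all $t$. Such an index tuple is called an embedding. An uncertain sequence $S$ is a sequence $\langle f_1\cdots f_n\rangle$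 together with an existential probability in $(0,1]$ for each item of each event. An uncertain sequential database $DB$ is a finite collection of uncertain sequences (called data sequences). The probability of an embedding of $\alpha$ in $S$ is the product, over all item occurrences of $\alpha$, of the existential probabilities of the items of $S$ to which they are matched. Let $P_S(\alpha)$ be the maximum of these products over all embeddings of $\alpha$ in $S$ ($0$ if there is none). The expected support is $$expSup(\alpha)=\sum_{S\in DB}P_S(\alpha).$$ Projected database: $DB|\beta$ is the projection of $DB$ with prefix $\beta$ in the sense of PrefixSpan. It consists of the data sequences containing $\beta$, each restricted to the places at which $\beta$ can be extended ($DB|\beta=DB$ for $\beta$ empty). Concretely, for an item $i$ appended to $\beta$ and a data sequence $S=\langle f_1\cdots f_n\rangle$, the admissible positions are: - for an s-extension, the indices $j$ with $i\in f_j$ such that $\beta$ has an embedding in $S$ using only events with index $<j$ (if $\beta$ is empty, all $j$ with $i\in f_j$); - for an i-extension, the indices $j$ with $i\in f_j$ such that $\beta$ has an embedding in $S$ whose last event is mapped to $f_j$. In the projected database $DB|\beta$, $maxPr_S(i)$ denotes the maximum existential probability of $i$ in $S$ over the admissible positions ($0$ if there is none), and $\widehat P_{DB|\beta}(i)=\max_{S}maxPr_S(i)$. For $\alpha$ of length $m\geq 1$ with items $i_1,\dots,i_m$, set $$maxPr(\alpha)=\prod_{k=1}^{m}\widehat P_{DB|\alpha_{k-1}}(i_k),\qquad maxPr(\text{empty sequence})=1,$$ $$expSup^{cap}(\alpha)=maxPr(\alpha_{m-1})\times\sum_{S\in DB|\alpha_{m-1}}maxPr_S(i_m),$$ where each $i_k$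 is appended to $\alpha_{k-1}$ by the extension type with which it occurs in $\alpha$, and $maxPr_S(i_m)$ is evaluated in the projected database $DB|\alpha_{m-1}$. *)

(* Defs.v *)
From HB Require Import structures.
From mathcomp Require Import all_boot all_order all_algebra.
Set Implicit Arguments.
Unset Strict Implicit.
Unset Printing Implicit Defensive.

Import Order.TTheory GRing.Theory Num.Theory.
Local Open Scope ring_scope.

(* Positions, indices and prefixes are counted from 0, so the item i_(k+1),   *)
(* which is appended to the prefix of length k, is entry k of [occurrences].  *)

Section Sequences.
Context {disp : Order.disp_t} {I : finOrderType disp}.
Implicit Types (a b f : seq {set I}) (e : {set I}).

Definition is_sequence a : bool := set0 \notin a.

Definition embedding a f (h : {ffun 'I_(size a) -> 'I_(size f)}) : bool :=
  [forall t1 : 'I_(size a), forall t2 : 'I_(size a),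
     (t1 < t2)%N ==> (h t1 < h t2)%N] &&
  [forall t : 'I_(size a),
     tnth (in_tuple a) t \subset tnth (in_tuple f) (h t)].

Definition subsequence a f : bool :=
  [exists h : {ffun 'I_(size a) -> 'I_(size f)}, embedding h].

Definition seq_length a : nat := (\sum_(e <- a) #|e|)%N.

Inductive extension := SExt | IExt.

(* [enum e] follows the enumeration of the finite type I, which need not      *)
(* agree with the order on I, hence the sort.                                 *)
Definition event_occurrences e : seq (extension * I) :=
  if sort <=%O (enum e) is i :: s then (SExt, i) :: [seq (IExt, x) | x <- s]
  else [::].

(* The items i_1, ..., i_m of a, each with its extension type in a.           *)
Definition occurrences a : seq (extension * I) :=
  flatten [seq event_occurrences e | e <- a].

Definition extend b (x : extension * I) : seq {set I} :=
  match x.1 with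
  | SExt => rcons b [set x.2]
  | IExt => if b is e :: b' then rcons (belast e b') (x.2 |: last e b')
            else [::]
  end.

(* Built by successive extensions; [seq_prefix_length] checks that they       *)
(* rebuild the whole sequence.                                                *)
Definition seq_prefix (k : nat) a : seq {set I} :=
  foldl extend [::] (take k (occurrences a)).

Lemma size_occurrences a : size (occurrences a) = seq_length a.
Proof.
rewrite /occurrences /seq_length size_flatten /shape -map_comp sumnE big_map.
apply: eq_bigr => e _ /=; rewrite /event_occurrences cardE.
by rewrite -(size_sort <=%O); case: sort => //= i s; rewrite size_map.
Qed.

Lemma seq_prefix_length a : is_sequence a -> seq_prefix (seq_length a) a = a.
Proof.
have ext_last s b e : foldl extend (rcons b e) [seq (IExt, x) | x <- s]
    = rcons b (e :|: [set x in s]).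
  elim: s e => [|x s IHs] e /=; first by rewrite set_nil setU0.
  have -> : extend (rcons b e) (IExt, x) = rcons b (x |: e).
    by case: (b) => [|c b'] //=; rewrite /extend /= belast_rcons last_rcons.
  rewrite IHs; congr rcons; apply/setP => y.
  by rewrite !inE orbCA orbA.
move=> a_ok; rewrite /seq_prefix -size_occurrences take_size.
suff gen b : foldl extend b (occurrences a) = b ++ a by rewrite gen.
elim: a b a_ok => [|e a IHa] b; first by rewrite cats0.
rewrite /is_sequence inE negb_or eq_sym => /andP[e0 a_ok].
rewrite /occurrences /= foldl_cat IHa // -cat_rcons; congr (_ ++ _).
have sE : sort <=%O (enum e) =i e by move=> x; rewrite mem_sort mem_enum.
rewrite /event_occurrences; case: sort sE => [|i s] sE /=.
  by case/set0Pn: e0 => x; rewrite -sE.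
rewrite {2}/extend /= ext_last; congr rcons; apply/setP => x.
by rewrite -sE !inE.
Qed.

End Sequences.

(* [pr S j i] is meaningful only when i belongs to event j of S; it is        *)
(* arbitrary, and never used, elsewhere.                                      *)
Record usequence {disp : Order.disp_t} (I : finOrderType disp)
    (R : realFieldType) := USequence {
  events : seq {set I};
  pr : 'I_(size events) -> I -> R;
  events_sequence : is_sequence events;
  pr_itv : forall (j : 'I_(size events)) (i : I),
    i \in tnth (in_tuple events) j -> 0 < pr j i <= 1
}.
Arguments pr {disp I R} S j i : rename.

Section ExpectedSupport.
Context {disp : Order.disp_t} {I : finOrderType disp} {R : realFieldType}.
Implicit Types (a b : seq {set I}) (x : extension * I).
Implicit Types (S : usequence I R) (DB : seq (usequence I R)).

Definition embedding_prob a S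
    (h : {ffun 'I_(size a) -> 'I_(size (events S))}) : R :=
  \prod_(t < size a) \prod_(i in tnth (in_tuple a) t) pr S (h t) i.

(* All the maxima below are taken over nonnegative numbers, so the default    *)
(* value 0 only matters when the index set is empty.                          *)
Definition seq_prob S a : R :=
  \big[Num.max/0]_(h : {ffun 'I_(size a) -> 'I_(size (events S))}
                   | embedding h) embedding_prob h.

Definition expSup DB a : R := \sum_(S <- DB) seq_prob S a.

Definition admissible b x S (j : 'I_(size (events S))) : bool :=
  (x.2 \in tnth (in_tuple (events S)) j) &&
  [exists h : {ffun 'I_(size b) -> 'I_(size (events S))},
     embedding h &&
     match x.1 with
     | SExt => [forall t : 'I_(size b), (h t < j)%N]
     | IExt => [exists t : 'I_(size b), (t.+1 == size b) && (h t == j)]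
     end].

(* The data sequences of the projected database; their restriction to the     *)
(* places where b can be extended is carried by [admissible].                 *)
Definition projection DB b : seq (usequence I R) :=
  [seq S <- DB | subsequence b (events S)].

Definition maxPrS b x S : R :=
  \big[Num.max/0]_(j < size (events S) | admissible b x j) pr S j x.2.

Definition Phat DB b x : R :=
  \big[Num.max/0]_(S <- projection DB b) maxPrS b x S.

Definition maxPr DB a : R :=
  \prod_(k < size (occurrences a))
    Phat DB (seq_prefix k a) (tnth (in_tuple (occurrences a)) k).

(* The value 0 at the empty sequence is a convention; the bound is defined    *)
(* for nonempty sequences only.                                               *)
Definition expSupcap DB a : R :=
  if occurrences a is x :: s then
    let b := seq_prefix (seq_length a).-1 a in
    maxPr DB b * \sum_(S <- projection DB b) maxPrS b (last x s) S
  else 0.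

End ExpectedSupport.

(* Main.v *)
(** Deleting the last item of a sequence [b'] leaves a sequence [b], and an
    embedding of [b'] restricts to one of [b] whose probability is that of the
    embedding of [b'] divided by the probability of the item matched at an
    admissible position.  Hence [P_S b' <= P_S b * maxPr_S x], and by induction
    [P_S] is bounded by the product [maxPr]; one more step, summed over the data
    sequences, gives the cap.  Antitonicity holds because embeddings compose
    and all the factors lost by restricting an embedding are at most [1]. *)
Require Import Defs.
From mathcomp Require Import all_boot all_order all_algebra.
Set Implicit Arguments.
Unset Strict Implicit.
Unset Printing Implicit Defensive.
Import Order.TTheory GRing.Theory Num.Theory.
Local Open Scope ring_scope.

(** * Finite products *)

Lemma prod_le1_subset (R : realFieldType) (T : finType) (P Q : pred T)
    (F : T -> R) :
    (forall t, P t -> 0 <= F t <= 1) -> (forall t, Q t -> P t) ->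
  \prod_(t | P t) F t <= \prod_(t | Q t) F t.
Proof.
move=> F01 QP; rewrite (bigID Q) /=.
have -> : \prod_(t | P t && Q t) F t = \prod_(t | Q t) F t.
  by apply: eq_bigl => t; case: (boolP (Q t)) => [/QP->|]; rewrite ?andbF.
apply: ler_piMr.
  by apply: prodr_ge0 => t /QP /F01 /andP[].
by apply: prodr_ile1 => t /andP[/F01].
Qed.

(** [size (rcons b e)] equals [(size b).+1] only propositionally; taking the equality as an argument
    leaves the type of an embedding untouched when its last factor is split off. *)
Lemma prod_ord_last (R : comPzRingType) (m n : nat) (mn : m = n.+1)
    (F : 'I_m -> R) :
  \prod_(t < m) F t =
  (\prod_(t < n) F (cast_ord (esym mn) (widen_ord (leqnSn n) t))) *
  F (cast_ord (esym mn) ord_max).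
Proof.
subst m; rewrite big_ord_recr /= cast_ord_id; congr (_ * _).
by apply: eq_bigr => t _; rewrite cast_ord_id.
Qed.

(** * Embeddings and their restriction along an appended item *)

Section Sequences.
Context {disp : Order.disp_t} {I : finOrderType disp}.
Implicit Types (a b f : seq {set I}) (e : {set I}) (x : extension * I).

Lemma tnth_in_tuple a (t : 'I_(size a)) : tnth (in_tuple a) t = nth set0 a t.
Proof. exact: tnth_nth. Qed.

Lemma embeddingP a f (h : {ffun 'I_(size a) -> 'I_(size f)}) :
  reflect ((forall t1 t2 : 'I_(size a), (t1 < t2)%N -> (h t1 < h t2)%N) /\
           (forall t, tnth (in_tuple a) t \subset tnth (in_tuple f) (h t)))
          (embedding h).
Proof.
apply: (iffP andP) => -[h_mono h_sub]; split.
- by move=> t1 t2; move/forallP/(_ t1)/forallP/(_ t2)/implyP: h_mono; apply.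
- exact/forallP.
- by apply/forallP => t1; apply/forallP => t2; apply/implyP/h_mono.
- exact/forallP.
Qed.

Lemma embedding_inj a f (h : {ffun 'I_(size a) -> 'I_(size f)}) :
  embedding h -> injective h.
Proof.
case/embeddingP=> h_mono _ t1 t2 h12; apply/val_inj.
by case: (ltngtP t1 t2) => // /h_mono; rewrite h12 ltnn.
Qed.

Lemma embedding_comp a b f (g : {ffun 'I_(size a) -> 'I_(size b)})
    (h : {ffun 'I_(size b) -> 'I_(size f)}) :
  embedding g -> embedding h -> embedding [ffun t => h (g t)].
Proof.
move=> /embeddingP[g_mono g_sub] /embeddingP[h_mono h_sub].
apply/embeddingP; split=> [t1 t2 t12|t]; rewrite !ffunE.
  exact/h_mono/g_mono.
exact: subset_trans (g_sub t) (h_sub _).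
Qed.

(* Unlike an i-extension of the paper, [AppendsI] only asks that [i] be new   *)
(* in the last event: its rank there does not affect the probabilities.       *)
Inductive appends : seq {set I} -> extension * I -> seq {set I} -> Prop :=
| AppendsS b i : appends b (SExt, i) (rcons b [set i])
| AppendsI b e i : i \notin e ->
    appends (rcons b e) (IExt, i) (rcons b (i |: e)).

Lemma appends_size b x b' : appends b x b' -> (size b <= size b')%N.
Proof. by case=> *; rewrite !size_rcons. Qed.

(** Appending an item never shifts the events already present, so restricting an embedding of [b']
    to [b] is precomposition with this inclusion of indices. *)
Definition appends_ord b x b' (bb' : appends b x b') :
    {ffun 'I_(size b) -> 'I_(size b')} :=
  [ffun t => widen_ord (appends_size bb') t].

Lemma embedding_appends b x b' (bb' : appends b x b') :
  embedding (appends_ord bb').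
Proof.
apply/embeddingP; split=> [t1 t2|t]; rewrite !ffunE //.
rewrite !tnth_in_tuple /=; case: t => t /=.
case: bb' => [{}b i|{}b e i _]; rewrite ?size_rcons !nth_rcons.
  by move->.
by rewrite ltnS leq_eqVlt; case: ltngtP => //= _ _; apply: subsetUr.
Qed.

(** * Deleting the last item of a sequence *)

Lemma sort_setD1_last e s i :
  sort <=%O (enum e) = rcons s i -> sort <=%O (enum (e :\ i)) = s.
Proof.
move=> es.
have uq : uniq (rcons s i) by rewrite -es sort_uniq enum_uniq.
have so : sorted <=%O (rcons s i) by rewrite -es sort_le_sorted.
have sE y : (y \in rcons s i) = (y \in e) by rewrite -es mem_sort mem_enum.
move: uq; rewrite rcons_uniq => /andP[i_s s_uq].
(* Two sorted lists that are permutations of each other coincide, and [s] inherits sortedness from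
   [rcons s i]. *)
apply: le_sorted_eq; first exact: sort_le_sorted.
  by apply: subseq_sorted so; [exact: le_trans | exact: subseq_rcons].
apply: uniq_perm => //; first by rewrite sort_uniq enum_uniq.
move=> y; rewrite mem_sort mem_enum in_setD1 -sE mem_rcons inE.
by case: eqP => [->|//]; rewrite (negPf i_s).
Qed.

Lemma occurrences_rcons a e :
  occurrences (rcons a e) = occurrences a ++ event_occurrences e.
Proof. by rewrite /occurrences map_rcons flatten_rcons. Qed.

(** The item to delete is the largest one of the last event. If it is alone there, the event
    disappears and the item was an s-extension; otherwise a nonempty event remains and it was an
    i-extension. *)
Lemma sequence_appends a : is_sequence a -> a != [::] ->
  exists b x, [/\ is_sequence b, appends b x a
                & occurrences a = rcons (occurrences b) x].
Proof.
case/lastP: a => [//|c e]; rewrite /is_sequence mem_rcons inE negb_or eq_sym.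
move=> /andP[e0 c_ok] _.
case/lastP es : (sort <=%O (enum e)) => [|s i].
  by case/set0Pn: e0 => y; rewrite -mem_enum -(mem_sort <=%O) es.
have ie : i \in e by rewrite -mem_enum -(mem_sort <=%O) es mem_rcons mem_head.
have eE : i |: (e :\ i) = e by rewrite setD1K.
have sE := sort_setD1_last es.
case: s es sE => [|k s] es sE.
  exists c, (SExt, i); split => //.
    have -> : e = [set i].
      by apply/setP => y; rewrite -mem_enum -(mem_sort <=%O) es !inE.
    exact: AppendsS.
  by rewrite occurrences_rcons /event_occurrences es cats1.
exists (rcons c (e :\ i)), (IExt, i); split.
- rewrite mem_rcons inE negb_or c_ok andbT eq_sym.
  by apply/set0Pn; exists k; rewrite -mem_enum -(mem_sort <=%O) sE mem_head.
- by rewrite -{2}eE; apply: AppendsI; rewrite !inE eqxx.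
- rewrite !occurrences_rcons /event_occurrences es sE /= map_rcons.
  by rewrite rcons_cat.
Qed.

Lemma seq_prefix_appends a b x k : is_sequence b ->
    occurrences a = rcons (occurrences b) x -> (k <= seq_length b)%N ->
  seq_prefix k a = seq_prefix k b.
Proof.
move=> b_ok ab kb; rewrite /seq_prefix ab -cats1 take_cat size_occurrences.
case: ltngtP kb => // -> _; rewrite subnn take0 cats0.
by rewrite -size_occurrences take_size.
Qed.

End Sequences.

(** * Probabilities of embeddings and bounds on the expected support *)

Section ExpectedSupport.
Context {disp : Order.disp_t} {I : finOrderType disp} {R : realFieldType}.
Implicit Types (a b : seq {set I}) (x : extension * I).
Implicit Types (S : usequence I R) (DB : seq (usequence I R)).

Lemma embedding_pr a S (h : {ffun 'I_(size a) -> 'I_(size (events S))}) t i :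
  embedding h -> i \in tnth (in_tuple a) t -> 0 <= pr S (h t) i <= 1.
Proof.
case/embeddingP=> _ /(_ t)/subsetP h_sub /h_sub /pr_itv /andP[/ltW -> ->].
by [].
Qed.

Lemma event_prob_itv a S (h : {ffun 'I_(size a) -> 'I_(size (events S))}) t :
  embedding h -> 0 <= \prod_(i in tnth (in_tuple a) t) pr S (h t) i <= 1.
Proof.
move=> h_emb; rewrite prodr_ge0 => [|i /(embedding_pr h_emb)/andP[]//].
by apply: prodr_ile1 => i /(embedding_pr h_emb).
Qed.

Lemma embedding_prob_ge0 a S
    (h : {ffun 'I_(size a) -> 'I_(size (events S))}) :
  embedding h -> 0 <= embedding_prob h.
Proof.
by move=> h_emb; apply: prodr_ge0 => t _; case/andP: (event_prob_itv t h_emb).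
Qed.

Lemma seq_prob_ge0 S a : 0 <= seq_prob S a.
Proof. exact: bigmax_ge_id. Qed.

Lemma maxPrS_ge0 b x S : 0 <= maxPrS b x S.
Proof. exact: bigmax_ge_id. Qed.

Lemma Phat_ge0 DB b x : 0 <= Phat DB b x.
Proof. exact: bigmax_ge_id. Qed.

Lemma maxPr_ge0 DB a : 0 <= maxPr DB a.
Proof. by apply: prodr_ge0 => k _; apply: Phat_ge0. Qed.

Lemma seq_prob_eq0 S a : ~~ subsequence a (events S) -> seq_prob S a = 0.
Proof.
move=> /existsPn aS; rewrite /seq_prob big_pred0 // => h.
exact/negbTE/aS.
Qed.

Lemma seq_prob_antitone S a a' :
  subsequence a a' -> seq_prob S a' <= seq_prob S a.
Proof.
case/existsP=> g g_emb; apply: bigmax_le => [|h h_emb]; first exact: seq_prob_ge0.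
have gh_emb := embedding_comp g_emb h_emb.
apply: le_trans (le_bigmax_cond 0 (@embedding_prob _ _ _ a S) gh_emb).
have g_inj := embedding_inj g_emb.
(* Factors are dropped in two rounds: first the events of [a'] outside the image of [g], then, after
   reindexing by the injective [g], the items of the remaining events that [a] lacks. *)
apply: (@le_trans _ _ (\prod_(t in [set g t | t in 'I_(size a)])
    \prod_(i in tnth (in_tuple a') t) pr S (h t) i)).
  by apply: prod_le1_subset => // t _; apply: event_prob_itv.
rewrite big_imset /=; last by move=> t1 t2 _ _; apply: g_inj.
apply: ler_prod => t _; case/andP: (event_prob_itv (g t) h_emb) => -> _ /=.
rewrite ffunE; apply: prod_le1_subset => i; first exact: embedding_pr.
by case/embeddingP: g_emb => _ /(_ t)/subsetP; apply.
Qed.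

(** The position [j] is the image under [h] of the last event of [b'], where the appended item is
    matched. *)
Lemma embedding_prob_appends b x b' S (bb' : appends b x b')
    (h : {ffun 'I_(size b') -> 'I_(size (events S))}) : embedding h ->
  exists2 j, admissible b x j &
    embedding_prob h =
    embedding_prob [ffun t => h (appends_ord bb' t)] * pr S j x.2.
Proof.
move=> h_emb; have hb_emb := embedding_comp (embedding_appends bb') h_emb.
have [h_mono h_sub] := embeddingP _ h_emb.
case: b x b' / bb' h h_emb hb_emb h_mono h_sub
  => [b i|b e i ie] h h_emb hb_emb h_mono h_sub.
  set l := cast_ord (esym (size_rcons b [set i])) ord_max.
  have lE : tnth (in_tuple (rcons b [set i])) l = [set i].
    by rewrite tnth_in_tuple nth_rcons ltnn eqxx.
  exists (h l).
    rewrite /admissible -sub1set -{1}lE h_sub /=.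
    apply/existsP; eexists; apply/andP; split; first exact: hb_emb.
    (* Strict monotonicity of [h] places all events of [b] before the image of the new one. *)
    by apply/forallP => t; rewrite !ffunE; apply: h_mono => /=.
  rewrite /embedding_prob (prod_ord_last (size_rcons b [set i])) lE big_set1.
  congr (_ * _); apply: eq_bigr => t _; rewrite !ffunE.
  set t' := cast_ord _ _; set t'' := widen_ord _ _.
  have -> : t' = t'' by apply/val_inj.
  by apply: eq_bigl => k; rewrite !tnth_in_tuple nth_rcons /= ltn_ord.
set l := cast_ord (esym (size_rcons b (i |: e))) ord_max.
set m := cast_ord (esym (size_rcons b e)) ord_max.
have lE : tnth (in_tuple (rcons b (i |: e))) l = i |: e.
  by rewrite tnth_in_tuple nth_rcons ltnn eqxx.
have mE : tnth (in_tuple (rcons b e)) m = e.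
  by rewrite tnth_in_tuple nth_rcons ltnn eqxx.
set bb' := AppendsI b ie in hb_emb *.
(* An i-extension creates no new index: the last events of both sequences share one, so the
   restricted embedding ends at [h l]. *)
have ml : appends_ord bb' m = l by rewrite ffunE; apply/val_inj.
exists (h l).
  rewrite /admissible (subsetP (h_sub l)) ?lE ?setU11 //=.
  apply/existsP; eexists; apply/andP; split; first exact: hb_emb.
  apply/existsP; exists m; rewrite ffunE ml eqxx andbT.
  exact/eqP/esym/size_rcons.
rewrite /embedding_prob (prod_ord_last (size_rcons b (i |: e))) lE.
(* Since [i] is new in [e], the product over [i |: e] splits off exactly one factor for [i], which
   is then moved to the end. *)
rewrite (prod_ord_last (size_rcons b e)) mE big_setU1 //= ffunE ml.
rewrite -mulrA [X in _ = _ * X]mulrC; congr (_ * _).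
apply: eq_bigr => t _; rewrite !ffunE.
set t' := cast_ord _ _; set t'' := widen_ord (appends_size _) _.
have -> : t' = t'' by apply/val_inj.
by apply: eq_bigl => k; rewrite !tnth_in_tuple !nth_rcons /= ltn_ord.
Qed.

Lemma seq_prob_appends b x b' S :
  appends b x b' -> seq_prob S b' <= seq_prob S b * maxPrS b x S.
Proof.
move=> bb'; apply: bigmax_le => [|h h_emb].
  by rewrite mulr_ge0 ?seq_prob_ge0 ?maxPrS_ge0.
have [j j_adm ->] := embedding_prob_appends bb' h_emb.
have hb_emb := embedding_comp (embedding_appends bb') h_emb.
apply: ler_pM.
- exact: embedding_prob_ge0.
- by case/andP: j_adm => /pr_itv/andP[/ltW].
- exact: (le_bigmax_cond 0 (@embedding_prob _ _ _ b S) hb_emb).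
- exact: (le_bigmax_cond 0 (fun j => pr S j x.2) j_adm).
Qed.

(** The data sequence is given by its index, as [usequence] carries no decidable equality with which
    to write membership in [DB]. *)
Lemma maxPrS_le_Phat DB b x (d : 'I_(size DB)) :
    subsequence b (events (tnth (in_tuple DB) d)) ->
  maxPrS b x (tnth (in_tuple DB) d) <= Phat DB b x.
Proof.
move=> bS; rewrite /Phat /projection big_filter big_tnth.
exact: (le_bigmax_cond 0 (fun d => maxPrS b x (tnth (in_tuple DB) d)) bS).
Qed.

Lemma seq_length_appends a b x :
  occurrences a = rcons (occurrences b) x -> seq_length a = (seq_length b).+1.
Proof. by rewrite -!size_occurrences => ->; rewrite size_rcons. Qed.

Lemma maxPr_appends DB a b x : is_sequence b ->
    occurrences a = rcons (occurrences b) x ->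
  maxPr DB a = maxPr DB b * Phat DB b x.
Proof.
move=> b_ok ab; rewrite /maxPr.
have ab_size : size (occurrences a) = (size (occurrences b)).+1.
  by rewrite ab size_rcons.
rewrite (prod_ord_last ab_size); congr (_ * _).
  apply: eq_bigr => k _ /=.
  rewrite (seq_prefix_appends b_ok ab) -?size_occurrences 1?ltnW //.
  by rewrite !(tnth_nth x) /= ab nth_rcons ltn_ord.
(* At the last index the prefix of [a] has the length of [b], hence is [b] itself. *)
rewrite (tnth_nth x) /= ab nth_rcons ltnn eqxx size_occurrences.
by rewrite (seq_prefix_appends b_ok ab) // seq_prefix_length.
Qed.

Lemma seq_prob_le_maxPr DB (d : 'I_(size DB)) a :
  is_sequence a -> seq_prob (tnth (in_tuple DB) d) a <= maxPr DB a.
Proof.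
set S := tnth _ d; have [n] := ubnP (seq_length a).
elim: n a => // n IHn a; have [->|a0] := eqVneq a [::].
  (* For the empty sequence both products are empty, and the bound reads [1 <= 1]. *)
  move=> _ _; apply: bigmax_le => [|h _]; first exact: maxPr_ge0.
  by rewrite /embedding_prob /maxPr !big_ord0.
move=> an /sequence_appends/(_ a0)[b [x [b_ok bxa ab]]].
rewrite (maxPr_appends DB b_ok ab).
apply: le_trans (seq_prob_appends S bxa) _.
(* [Phat] is a maximum over the sequences containing [b] only; for any other [S] the factor
   [seq_prob S b] is already [0]. *)
have [bS|bS] := boolP (subsequence b (events S)); last first.
  by rewrite seq_prob_eq0 // mul0r mulr_ge0 ?maxPr_ge0 ?Phat_ge0.
apply: ler_pM; rewrite ?seq_prob_ge0 ?maxPrS_ge0 ?maxPrS_le_Phat //.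
by apply: IHn => //; rewrite -ltnS -(seq_length_appends ab).
Qed.

Lemma expSup_antitone DB a a' :
  subsequence a a' -> expSup DB a' <= expSup DB a.
Proof. by move=> aa'; apply: ler_sum => S _; apply: seq_prob_antitone. Qed.

Lemma expSup_le_cap DB a :
  is_sequence a -> a != [::] -> expSup DB a <= expSupcap DB a.
Proof.
move=> a_ok a0; have [b [x [b_ok bxa ab]]] := sequence_appends a_ok a0.
have -> : expSupcap DB a =
    maxPr DB b * \sum_(S <- projection DB b) maxPrS b x S.
  rewrite /expSupcap (seq_length_appends ab) /=.
  rewrite (seq_prefix_appends b_ok ab) // seq_prefix_length //.
  case: (occurrences a) ab => [|y s ys]; first by case: (occurrences b).
  by have := congr1 (last x) ys; rewrite last_rcons /= => <-.
(* The sum over the projection is extended by zero to all of [DB], so that the two sums compare term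
   by term. *)
rewrite /expSup /projection big_filter mulr_sumr.
rewrite big_tnth [leRHS]big_tnth [leRHS]big_mkcond.
apply: ler_sum => d _; set S := tnth _ d.
apply: le_trans (seq_prob_appends S bxa) _.
have [bS|bS] := ifPn; last by rewrite seq_prob_eq0 // mul0r.
by rewrite ler_wpM2r ?maxPrS_ge0 ?seq_prob_le_maxPr.
Qed.

End ExpectedSupport.

Theorem lemma1 (disp : Order.disp_t) (I : finOrderType disp) (R : realFieldType)
    (DB : seq (usequence I R)) (a a' : seq {set I})
    (ha : is_sequence a) (ha' : is_sequence a')
    (a_neq0 : a != [::]) (a'_neq0 : a' != [::])
    (haa' : subsequence a a') :
  [/\ expSupcap DB a >= expSup DB a,
      expSup DB a >= expSup DB a',
      expSupcap DB a >= expSup DB a'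
    & forall gamma : R, expSupcap DB a < gamma ->
        expSup DB a < gamma /\
        (forall a'' : seq {set I}, is_sequence a'' -> subsequence a a'' ->
           expSup DB a'' < gamma)].
Proof.
have cap := expSup_le_cap DB ha a_neq0.
have anti a'' : subsequence a a'' -> expSup DB a'' <= expSup DB a.
  exact: expSup_antitone.
split=> [//|||gamma cap_lt]; first exact: anti.
  exact: le_trans (anti _ haa') cap.
have lt_gamma := le_lt_trans cap cap_lt.
by split=> // a'' _ /anti /le_lt_trans; apply.
Qed.
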